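(* Let $n\ge 2$, let $M_1,\ldots,M_n$ be positive real numbers, and let $\varepsilon>0$. Then there exist independent non-negative random variables $X_1,\ldots,X_n$ with finite first moment such that, for every $i=1,\ldots,n$, the expected value of the maximum of $n$ independent copies of $X_i$ equals $M_i$, and $$\mathbb{E}\left[\max(X_1,\ldots,X_n)\right]\geq \frac1n\sum_{i=1}^nM_i+\frac{n-1}{n}\max(M_1,\ldots,M_n)-\varepsilon .$$
   Context: Independent copies of $X_i$ are independent random variables each having the same distribution as $X_i$. *)

(* Defs.v *)
From HB Require Import structures.
From mathcomp Require Import all_boot all_order all_algebra.
From mathcomp Require Import all_classical all_reals all_analysis.
Import Order.TTheory GRing.Theory Num.Theory.

Set Implicit Arguments.
Unset Strict Implicit.
Unset Printing Implicit Defensive.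

Local Open Scope classical_set_scope.
Local Open Scope ring_scope.

(* Maximum of x_0, ..., x_(n-1); starting the fold at x_0 rather than at 0
   makes this the true maximum also when all the x_i are negative. The value
   0 for n = 0 is a dummy. *)
Definition maxfam (R : realType) (n : nat) : ('I_n -> R) -> R :=
  match n with
  | 0 => fun=> 0
  | m.+1 => fun x => \big[Num.max/x ord0]_(i < m.+1) x i
  end.

Definition mutually_independent (R : realType) (d : measure_display)
    (T : measurableType d) (P : probability T R) (n : nat)
    (X : 'I_n -> {RV P >-> R}) : Prop :=
  forall (A : {set 'I_n}) (B : 'I_n -> set R),
    (forall i, measurable (B i)) ->
    P [set w | forall i, i \in A -> B i (X i w)] =
    (\prod_(i in A) P (X i @^-1` B i))%E.

(* The laws are compared on measurable sets only: the value of a measure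
   outside of the sigma-algebra carries no meaning. *)
Definition same_distribution (R : realType) (d d' : measure_display)
    (T : measurableType d) (P : probability T R)
    (T' : measurableType d') (P' : probability T' R)
    (X : {RV P >-> R}) (Y : {RV P' >-> R}) : Prop :=
  forall B : set R, measurable B -> distribution P X B = distribution P' Y B.

(* The copies may live on another probability space than X. *)
Definition independent_copies (R : realType) (d d' : measure_display)
    (T : measurableType d) (P : probability T R)
    (T' : measurableType d') (P' : probability T' R)
    (n : nat) (X : {RV P >-> R}) (Y : 'I_n -> {RV P' >-> R}) : Prop :=
  mutually_independent Y /\ forall j, same_distribution X (Y j).

(* The expected value of the maximum of n independent copies of X is m: it
   does not depend on the realization of the copies, and requiring that one
   exists keeps the universal part from being vacuous. *)
Definition expected_max_copies_eq (R : realType) (d : measure_display)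
    (T : measurableType d) (P : probability T R)
    (n : nat) (X : {RV P >-> R}) (m : \bar R) : Prop :=
  (exists (d' : measure_display) (T' : measurableType d')
          (P' : probability T' R) (Y : 'I_n -> {RV P' >-> R}),
      independent_copies X Y) /\
  (forall (d' : measure_display) (T' : measurableType d')
          (P' : probability T' R) (Y : 'I_n -> {RV P' >-> R}),
      independent_copies X Y -> ('E_P'[fun w => maxfam (Y ^~ w)] = m)%E).

(* Main.v *)
Require Import Defs.
From HB Require Import structures.
From mathcomp Require Import all_boot all_order all_algebra.
From mathcomp Require Import all_classical all_reals all_analysis.
From mathcomp Require Import measurable_realfun ring lra.
Import Order.TTheory GRing.Theory Num.Theory.

Set Implicit Arguments.
Unset Strict Implicit.
Unset Printing Implicit Defensive.

Local Open Scope classical_set_scope.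
Local Open Scope ring_scope.

(** Let k be an index at which M is maximal. Take X_k constant, equal to M_k, and
for i <> k let X_i be a rare but large prize: X_i = a_i with a small probability
q and X_i = 0 otherwise. The maximum of n independent copies of a variable which
is a with probability p and 0 otherwise is a unless all the copies vanish, so its
expectation is a (1 - (1 - p)^n) ([expectation_max_two_valued]). This forces
a_i = M_i / (1 - (1 - p_i)^n), where p_k = 1 and p_i = q for i <> k. As q tends
to 0, a_i q tends to M_i / n: each prize contributes only M_i / n to the
expectation. Moreover, different prizes are almost never won together, and the
constant M_k is lost only when a prize is won. Hence the expectation of
max(X_1, ..., X_n) tends to M_k + (1/n) (sum of the M_i with i <> k), which is
the announced bound C.

Quantitatively, let F_i be the event that X_i = a_i and that all the other prizes
are lost; for i <> k it says nothing about X_k. These events are disjoint and max X >= a_i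
on F_i, so that E[max X] >= sum_i a_i P(F_i)
([disjoint_events_le_expectation_max]); independence gives
P(F_i) >= p_i (1 - q)^(n-1) ([coin_var_expectation_max_ge]), and Bernoulli's
inequality gives both a_i p_i >= M_i / n and (1 - q)^(n-1) >= 1 - n q. Altogether
E[max X] >= (1 - n q) C, and q = eps / (n (C + eps)) is small enough.

The variables live on the finite probability space of n independent biased coin
tosses, in which the probability of an event that constrains each toss separately
is computed by expanding a product of sums ([coin_law_cylinder]). *)

(** * Independent biased coin tosses *)
Definition outcomes (n : nat) : Type := {ffun 'I_n -> bool}.

HB.instance Definition _ n := Finite.on (outcomes n).
HB.instance Definition _ n := isPointed.Build (outcomes n) [ffun=> false].
HB.instance Definition _ n := @isMeasurable.Build default_measure_display
  (outcomes n) discrete_measurable discrete_measurable0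
  discrete_measurableC discrete_measurableU.

Definition coin_weight (R : realType) (p : R) (b : bool) : R :=
  if b then p else 1 - p.

Definition outcome_weight (R : realType) n (p : 'I_n -> R)
    (w : outcomes n) : R :=
  \prod_i coin_weight (p i) (w i).

Lemma outcome_weight_ge0 (R : realType) n (p : 'I_n -> R) (w : outcomes n) :
  (forall i, 0 <= p i <= 1) -> 0 <= outcome_weight p w.
Proof.
move=> hp; apply: prodr_ge0 => i _; rewrite /coin_weight.
by case/andP: (hp i) => p0 p1; case: ifP => // _; rewrite subr_ge0.
Qed.

(** Numbering the outcomes lets the law be written as a sum of weighted Dirac
masses indexed by natural numbers. *)
Definition nth_outcome n (k : nat) : outcomes n :=
  nth point (enum {: outcomes n}) k.

Definition coin_law (R : realType) n (p : 'I_n -> R)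
    (hp : forall i, 0 <= p i <= 1) : set (outcomes n) -> \bar R :=
  msum (fun k => mscale (NngNum (outcome_weight_ge0 (nth_outcome n k) hp))
    (dirac (nth_outcome n k))) #|{: outcomes n}|.

HB.instance Definition _ (R : realType) n (p : 'I_n -> R)
  (hp : forall i, 0 <= p i <= 1) := Measure.on (coin_law hp).

Lemma coin_lawE (R : realType) n (p : 'I_n -> R)
    (hp : forall i, 0 <= p i <= 1) (A : set (outcomes n)) :
  coin_law hp A =
  (\sum_(w : outcomes n) outcome_weight p w * (w \in A)%:R)%:E.
Proof.
rewrite /coin_law /= /msum /= -sumEFin.
rewrite (big_enum_val (fun w : outcomes n => (outcome_weight p w * (w \in A)%:R)%:E)) /=.
apply: eq_bigr => k _; rewrite /mscale /= diracE -EFinM.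
by rewrite (enum_val_nth (point : outcomes n)).
Qed.

(** The weights of the outcomes are products over the tosses, and so is the
indicator of the event: the sum of their products over all outcomes is the
expansion of a product of sums over single tosses. *)
Lemma coin_law_cylinder (R : realType) n (p : 'I_n -> R)
    (hp : forall i, 0 <= p i <= 1) (C : 'I_n -> set bool) :
  coin_law hp [set w | forall i, C i (w i)] =
  (\prod_i \sum_b coin_weight (p i) b * (b \in C i)%:R)%:E.
Proof.
rewrite coin_lawE bigA_distr_bigA /=; congr EFin; apply: eq_bigr => w _.
rewrite big_split /= -/(outcome_weight p w); congr (_ * _).
have [/set_mem wC|/negP wC] := boolP (w \in _).
  by rewrite big1 // => i _; rewrite mem_set //; exact: wC.
have /existsNP[i Ci] : ~ forall i, C i (w i) by move=> h; apply: wC; rewrite inE.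
by rewrite (bigD1 i) //= memNset // mul0r.
Qed.

Lemma sum_coin_weight (R : realType) (p : R) : \sum_b coin_weight p b = 1.
Proof. by rewrite big_bool /= addrC subrK. Qed.

Lemma coin_law_setT (R : realType) n (p : 'I_n -> R)
  (hp : forall i, 0 <= p i <= 1) : coin_law hp setT = 1%E.
Proof.
rewrite (_ : [set: outcomes n] = [set w | forall i, [set: bool] (w i)]); last first.
  by apply/seteqP; split.
rewrite (coin_law_cylinder hp (fun=> setT)) big1 // => i _.
under eq_bigr do rewrite in_setT mulr1.
exact: sum_coin_weight.
Qed.

HB.instance Definition _ (R : realType) n (p : 'I_n -> R)
  (hp : forall i, 0 <= p i <= 1) :=
  Measure_isProbability.Build _ _ _ (coin_law hp) (coin_law_setT hp).

(** * Independent two-valued random variables *)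
Definition coin_var (R : realType) n (a : 'I_n -> R) (i : 'I_n)
    (w : outcomes n) : R :=
  if w i then a i else 0.

Lemma measurable_coin_var (R : realType) n (a : 'I_n -> R) (i : 'I_n) :
  measurable_fun setT (coin_var a i).
Proof. by []. Qed.
HB.instance Definition _ (R : realType) n (a : 'I_n -> R) (i : 'I_n) :=
  isMeasurableFun.Build _ _ _ _ (coin_var a i) (measurable_coin_var a i).

(** An index outside of A leaves its toss free and contributes the total mass 1,
so that only the factors with index in A remain. *)
Lemma coin_var_event (R : realType) n (p : 'I_n -> R)
    (hp : forall i, 0 <= p i <= 1) (a : 'I_n -> R) (A : {set 'I_n})
    (B : 'I_n -> set R) :
  coin_law hp [set w | forall i, i \in A -> B i (coin_var a i w)] =
  (\prod_(i in A) (\sum_b coin_weight (p i) b *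
     ((if b then a i else 0) \in B i)%:R))%:E.
Proof.
pose C i : set bool := [set b | i \in A -> B i (if b then a i else 0)].
transitivity (coin_law hp [set w | forall i, C i (w i)]); first by [].
rewrite coin_law_cylinder [in RHS]big_mkcond /=; congr EFin.
apply: eq_bigr => i _; case: ifPn => iA.
  apply: eq_bigr => b _; congr (_ * (nat_of_bool _)%:R).
  by apply/idP/idP; rewrite !inE /C /=; [apply|].
rewrite -[RHS](sum_coin_weight (p i)); apply: eq_bigr => b _.
by rewrite mem_set ?mulr1 // /C /= (negbTE iA).
Qed.

(** The law of a variable depends only on its own parameters: this is what makes
it possible to realize independent copies with constant families of parameters. *)
Lemma coin_var_preimage (R : realType) n (p : 'I_n -> R)
    (hp : forall i, 0 <= p i <= 1) (a : 'I_n -> R) (i : 'I_n) (B : set R) :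
  coin_law hp (coin_var a i @^-1` B) =
  (p i * (a i \in B)%:R + (1 - p i) * (0 \in B)%:R)%:E.
Proof.
have := coin_var_event hp a [set i]%SET (fun=> B).
rewrite big_set1 big_bool /= => <-; congr (coin_law hp _).
apply/seteqP; split=> w /=; last by apply; rewrite inE.
by move=> Bw j; rewrite inE => /eqP ->.
Qed.

Lemma coin_var_independent (R : realType) n (p : 'I_n -> R)
    (hp : forall i, 0 <= p i <= 1) (a : 'I_n -> R) :
  mutually_independent
    (fun i => (coin_var a i : {RV (coin_law hp) >-> R})).
Proof.
move=> A B mB; apply: etrans (coin_var_event hp a A B) _.
rewrite -prodEFin; apply: eq_bigr => i _.
by rewrite big_bool; apply/esym; exact: coin_var_preimage.
Qed.

Lemma coin_var_Lfun1 (R : realType) n (p : 'I_n -> R)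
    (hp : forall i, 0 <= p i <= 1) (a : 'I_n -> R) (i : 'I_n) :
  coin_var a i \in Lfun (coin_law hp) 1.
Proof.
apply/Lfun1_integrable.
apply: le_integrable
  (finite_measure_integrable_cst (coin_law hp) `|a i| measurableT) => //.
move=> w _ /=; rewrite lee_fin normr_id /coin_var.
by case: ifP => // _; rewrite normr0.
Qed.

(** * The maximum of a family *)
Lemma measurable_joint_event (R : realType) d (T : measurableType d)
    (P : probability T R) n (X : 'I_n -> {RV P >-> R}) (A : {set 'I_n})
    (B : 'I_n -> set R) : (forall i, measurable (B i)) ->
  measurable [set w | forall i, i \in A -> B i (X i w)].
Proof.
move=> mB; rewrite (_ : [set w | _] = \bigcap_(i in [set` A]) (X i @^-1` B i)) //.
apply: fin_bigcap_measurable => [|i _]; first exact: finite_finset.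
by rewrite -[X in measurable X]setTI; exact: measurable_funP.
Qed.

Lemma le_maxfam (R : realType) n (x : 'I_n -> R) (i : 'I_n) : x i <= maxfam x.
Proof. by case: n x i => [x []|n x i] //; exact: le_bigmax. Qed.

Lemma maxfam_ge0 (R : realType) n (x : 'I_n -> R) :
  (forall i, 0 <= x i) -> 0 <= maxfam x.
Proof. by case: n x => [|n] x x0 //; apply: le_trans (x0 ord0) (le_maxfam _ _). Qed.

Lemma maxfam_attained (R : realType) n (x : 'I_n -> R) :
  (0 < n)%N -> exists i, maxfam x = x i.
Proof.
case: n x => // n x _.
have [h|[i _ h]] := bigmax_geP (x ord0) xpredT (maxfam x) x (lexx _).
  by exists ord0; apply/eqP; rewrite eq_le h le_maxfam.
by exists i; apply/eqP; rewrite eq_le h le_maxfam.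
Qed.

Lemma measurable_maxfam (R : realType) d (T : measurableType d) n
    (f : 'I_n -> T -> R) : (forall i, measurable_fun setT (f i)) ->
  measurable_fun setT (fun w => maxfam (f ^~ w)).
Proof.
case: n f => [|n] f mf /=; first exact: measurable_cst.
elim: (index_enum _) => [|i s ih].
  by under eq_fun do rewrite big_nil; exact: mf.
under eq_fun do rewrite big_cons /=.
exact: measurable_maxr.
Qed.

(** * The maximum of independent copies *)

(** Almost surely all the Y_j lie in {0, a}, and then their maximum is a times the
indicator that they do not all vanish. Only probabilities are prescribed, since
copies on an arbitrary space may take other values on a null set. *)
Lemma expectation_max_two_valued (R : realType) d (T : measurableType d)
    (P : probability T R) n (Y : 'I_n -> {RV P >-> R}) (p a : R) :
  (0 < n)%N -> 0 <= a -> mutually_independent Y ->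
  (forall j, P (Y j @^-1` [set 0]) = (1 - p)%:E) ->
  (forall j, P (Y j @^-1` [set 0; a]) = 1%E) ->
  'E_P[fun w => maxfam (Y ^~ w)]%E = (a * (1 - (1 - p) ^+ n))%:E.
Proof.
move=> n0 a0 indY Y0 Y0a.
pose N := [set w | forall j, j \in [set: 'I_n]%SET -> [set 0] (Y j w)].
pose G := [set w | forall j, j \in [set: 'I_n]%SET -> [set 0; a] (Y j w)].
have mN : measurable N.
  apply: (measurable_joint_event Y _ (B := fun=> [set 0])) => j.
  exact: measurable_set1.
have m0a : measurable [set 0; a] by apply: measurableU; exact: measurable_set1.
have mG : measurable G by exact: (measurable_joint_event Y _ (B := fun=> [set 0; a])).
have PN : P N = ((1 - p) ^+ n)%:E.
  rewrite (indY _ (fun=> [set 0])); last by move=> _; exact: measurable_set1.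
  under eq_bigr do rewrite Y0.
  by rewrite prodEFin prodr_const cardsT card_ord.
have PG : P (~` G) = 0%E.
  rewrite probability_setC // (indY _ (fun=> [set 0; a])) //.
  by rewrite big1 // subee.
rewrite unlock (ae_eq_integral (fun w => (a * \1_(~` N) w)%:E)) //.
- under eq_integral do rewrite EFinM.
  rewrite ge0_integralZl //; last first.
    by apply/measurable_EFinP; apply: measurable_indic; exact: measurableC.
  rewrite integral_indic ?setIT //; last exact: measurableC.
  by rewrite EFinM; congr (_ * _)%E; apply: etrans (probability_setC P mN) _; rewrite PN.
- by apply/measurable_EFinP; apply: measurable_maxfam => j.
- apply/measurable_EFinP; apply: measurable_funM => //.
  by apply: measurable_indic; exact: measurableC.
- exists (~` G); split=> //; first exact: measurableC.
  apply: subsetC => w Gw _ /=; congr EFin.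
  have Yw j : Y j w = 0 \/ Y j w = a by apply: Gw; rewrite inE.
  rewrite indicE in_setC.
  have [/set_mem Nw|Nw] := boolP (w \in N).
    have [j ->] := maxfam_attained (Y ^~ w) n0.
    by rewrite Nw ?inE // mulr0.
  have [i Yi] : exists i, Y i w = a.
    apply: contrapT => /forallNP h; move/negP: Nw; apply; rewrite inE => j _.
    by have [//|/h] := Yw j.
  rewrite mulr1; apply/eqP; rewrite eq_le -{2}Yi (le_maxfam (Y ^~ w)) andbT.
  by have [j ->] := maxfam_attained (Y ^~ w) n0; have [->|->] := Yw j.
Qed.

(** The copies exist as tosses of n coins with the same bias, and any other copies
have the same probabilities of being 0 and of lying in {0, a i}. *)
Lemma coin_var_expected_max_copies (R : realType) n (p : 'I_n -> R)
    (hp : forall i, 0 <= p i <= 1) (a : 'I_n -> R) (i : 'I_n) :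
  0 < a i ->
  expected_max_copies_eq n (coin_var a i : {RV (coin_law hp) >-> R})
    (a i * (1 - (1 - p i) ^+ n))%:E.
Proof.
move=> ai0; split.
  exists default_measure_display, (outcomes n),
    (coin_law (fun _ : 'I_n => hp i)), (coin_var (fun=> a i)).
  split; first exact: coin_var_independent.
  move=> j B mB; apply: etrans (coin_var_preimage hp a i B) _; apply/esym.
  exact: (coin_var_preimage (fun=> hp i) (fun=> a i) j B).
move=> d' T' P' Y [indY sameY].
have PY j B : measurable B -> P' (Y j @^-1` B) =
    (p i * (a i \in B)%:R + (1 - p i) * (0 \in B)%:R)%:E.
  by move=> mB; apply: etrans (esym (sameY j B mB)) (coin_var_preimage hp a i B).
apply: expectation_max_two_valued => //.
- by rewrite (leq_ltn_trans _ (ltn_ord i)).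
- exact: ltW.
- move=> j; rewrite PY; last exact: measurable_set1.
  rewrite memNset => [|/eqP]; last by rewrite gt_eqF.
  by rewrite mem_set // mulr0 mulr1 add0r.
- move=> j; rewrite PY; last by apply: measurableU; exact: measurable_set1.
  rewrite !mem_set /=; [|by left|by right].
  by rewrite !mulr1 addrC subrK.
Qed.

(** * The maximum of the different variables *)

(** The function equal to a i on F i, and to 0 elsewhere, lies below the maximum. *)
Lemma disjoint_events_le_expectation_max (R : realType) d
    (T : measurableType d) (P : probability T R) n (X : 'I_n -> {RV P >-> R})
    (a : 'I_n -> R) (F : 'I_n -> set T) :
  (forall i w, 0 <= X i w) -> (forall i, 0 <= a i) ->
  (forall i, measurable (F i)) -> trivIset setT F ->
  (forall i w, F i w -> a i <= X i w) ->
  (\sum_i (a i)%:E * P (F i) <= 'E_P[fun w => maxfam (X ^~ w)])%E.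
Proof.
move=> X0 a0 mF tF aX.
have mI i : measurable_fun setT (fun w => (a i * \1_(F i) w)%:E).
  by apply/measurable_EFinP; apply: measurable_funM => //; exact: measurable_indic.
have I0 i w : (0 <= (a i * \1_(F i) w)%:E)%E by rewrite lee_fin mulr_ge0.
rewrite (_ : (\sum_i _)%E =
    (\int[P]_w \sum_i (a i * \1_(F i) w)%:E)%E); last first.
  rewrite ge0_integral_sum //; apply: eq_bigr => i _.
  under eq_integral do rewrite EFinM.
  rewrite ge0_integralZl ?lee_fin //; last first.
    by apply/measurable_EFinP; exact: measurable_indic.
  by rewrite integral_indic ?setIT.
rewrite expectation.unlock; apply: ge0_le_integral => //.
- by move=> w _; apply: sume_ge0 => i _; exact: I0.
- by apply: emeasurable_sum => i; exact: mI.
- by apply/measurable_EFinP; apply: measurable_maxfam => j.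
move=> w _; rewrite sumEFin lee_fin.
have [[i Fi]|noF] := pselect (exists i, F i w).
  rewrite (bigD1 i) //= big1 ?addr0 => [|j ji].
    rewrite indicE mem_set // mulr1; apply: le_trans (aX _ _ Fi) _.
    exact: (le_maxfam (X ^~ w)).
  rewrite indicE memNset ?mulr0 // => Fj; move/eqP: ji; apply.
  by apply: (tF j i) => //; exists w.
rewrite big1 ?maxfam_ge0 // => i _; rewrite indicE memNset ?mulr0 // => Fi.
by apply: noF; exists i.
Qed.

Lemma bernoulli_ineq (R : realType) (p : R) (m : nat) :
  0 <= p <= 1 -> 1 - m%:R * p <= (1 - p) ^+ m.
Proof.
case/andP=> p0 p1; elim: m => [|m ih]; first by rewrite mul0r subr0 expr0.
have q0 : 0 <= 1 - p by rewrite subr_ge0.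
rewrite exprS; apply: le_trans (ler_wpM2l q0 ih).
rewrite -subr_ge0 (_ : _ - _ = m%:R * p ^+ 2).
  by rewrite mulr_ge0 // exprn_ge0.
by rewrite -natr1 expr2; ring.
Qed.
(** The events used here are F i: the i-th variable takes its nonzero value and all
the others vanish, except the k-th, on which nothing is asked when i <> k. They
are disjoint since, for i <> i', one of i, i' differs from k, and the variable
with that index would be both zero and nonzero on the intersection. *)
Lemma coin_var_expectation_max_ge (R : realType) n (p : 'I_n -> R)
    (hp : forall i, 0 <= p i <= 1) (a : 'I_n -> R) (k : 'I_n) (q : R) :
  (forall i, 0 < a i) -> 0 <= q <= 1 -> (forall j, j != k -> p j = q) ->
  (((1 - q) ^+ n.-1 * \sum_i a i * p i)%:E <=
   'E_(coin_law hp)[fun w => maxfam ((coin_var a) ^~ w)])%E.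
Proof.
move=> a0 /andP[q0 q1] pq.
pose B i j : set R :=
  if j == i then [set a i] else if j == k then setT else [set 0].
pose F i : set (outcomes n) :=
  [set w | forall j, j \in [set: 'I_n]%SET -> B i j (coin_var a j w)].
have q'0 : 0 <= 1 - q by rewrite subr_ge0.
have q'1 : 1 - q <= 1 by rewrite gerBl.
have PF i : ((p i * (1 - q) ^+ n.-1)%:E <= coin_law hp (F i))%E.
  rewrite /F coin_var_event lee_fin (bigD1 i) ?inE //=.
  have p0 : 0 <= p i by case/andP: (hp i).
  apply: ler_pM => //.
  - exact: exprn_ge0.
  - rewrite big_bool /= {1}/B eqxx mem_set // mulr1 lerDl mulr_ge0 //.
    by rewrite subr_ge0; case/andP: (hp i).
  rewrite (eq_bigl (predC1 i)) => [|j]; last by rewrite !inE.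
  rewrite -[n in n.-1]card_ord -(cardC1 i) -prodr_const.
  apply: ler_prod => j /negPf ji; rewrite q'0 big_bool /= /B ji.
  have [jk|jk] := eqVneq j k; first by rewrite !in_setT !mulr1 addrC subrK.
  rewrite (pq _ jk) memNset => [|/eqP]; last by rewrite gt_eqF.
  by rewrite mem_set // mulr0 add0r mulr1.
have tF : trivIset setT F.
  apply/trivIsetP => i i' _ _ ii'; apply/seteqP; split=> w //= [Fi Fi'].
  have hi j : B i j (coin_var a j w) by apply: Fi; rewrite inE.
  have hi' j : B i' j (coin_var a j w) by apply: Fi'; rewrite inE.
  have [i'k|i'k] := eqVneq i' k.
    have := hi i; have := hi' i; rewrite /B eqxx (negbTE ii') -i'k (negbTE ii').
    by move=> -> /eqP; rewrite lt_eqF.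
  have := hi i'; have := hi' i'; rewrite /B eqxx eq_sym (negbTE ii') (negbTE i'k).
  by move=> -> /eqP; rewrite gt_eqF.
apply: le_trans (disjoint_events_le_expectation_max
  (X := fun i => (coin_var a i : {RV (coin_law hp) >-> R})) (a := a) (F := F) _ _ _ tF _).
- rewrite mulr_sumr -sumEFin; apply: lee_sum => i _.
  apply: le_trans (lee_wpmul2l _ (PF i)); last by rewrite lee_fin ltW.
  by rewrite -EFinM lee_fin mulrC mulrA.
- by move=> i w; rewrite /= /coin_var; case: ifP => // _; exact: ltW.
- by move=> i; exact: ltW.
- by [].
- by move=> i w /(_ i); rewrite inE /B eqxx => /(_ isT) /= ->; exact: lexx.
Qed.

Theorem mainTheorem3 (R : realType) (n : nat) (hn : (2 <= n)%N)
    (M : 'I_n -> R) (hM : forall i, 0 < M i) (eps : R) (heps : 0 < eps) :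
  exists (d : measure_display) (T : measurableType d) (P : probability T R)
         (X : 'I_n -> {RV P >-> R}),
    [/\ mutually_independent X,
        forall i w, 0 <= X i w,
        forall i, (X i : T -> R) \in Lfun P 1,
        forall i, expected_max_copies_eq n (X i) (M i)%:E
      & ((n%:R^-1 * (\sum_(i < n) M i) + (n.-1)%:R / n%:R * maxfam M - eps)%:E
          <= 'E_P[fun w => maxfam (X ^~ w)])%E].
Proof.
have n0 : (0 < n)%N by exact: ltnW.
have nR : 0 < n%:R :> R by rewrite ltr0n.
have [k Mk] := maxfam_attained M n0.
(* The value of the bound before eps is subtracted. *)
set C := n%:R^-1 * _ + _.
have C0 : 0 < C.
  rewrite /C Mk ltr_pwDl //; last by rewrite mulr_ge0 ?divr_ge0 // ltW.
  rewrite mulr_gt0 ?invr_gt0 // (bigD1 k) //= ltr_pwDl //.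
  by apply: sumr_ge0 => i _; exact: ltW.
(* This q satisfies n q C <= eps, and q <= 1. *)
pose q := eps / (n%:R * (C + eps)).
have den0 : 0 < n%:R * (C + eps) by rewrite mulr_gt0 // addr_gt0.
have q0 : 0 < q by rewrite divr_gt0.
have n1 : 1 <= n%:R :> R by rewrite ler1n.
have nqC : n%:R * q * C <= eps.
  rewrite /q (_ : _ * C = eps * (C / (C + eps))); last by field; lra.
  by rewrite ger_pMr // ler_pdivrMr ?mul1r; lra.
have q1 : q <= 1.
  rewrite /q ler_pdivrMr // mul1r.
  apply: (@le_trans _ _ (1 * (C + eps))); first by rewrite mul1r lerDr ltW.
  by rewrite ler_pM2r // addr_gt0.
pose p i := if i == k then 1 else q.
have p01 i : 0 < p i <= 1 by rewrite /p; case: ifP; rewrite ?ltr01 ?lexx ?q0 ?q1.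
have hp i : 0 <= p i <= 1 by case/andP: (p01 i) => /ltW -> ->.
pose c i := 1 - (1 - p i) ^+ n.
have c0 i : 0 < c i.
  case/andP: (p01 i) => pi0 pi1.
  by rewrite subr_gt0 exprn_ilt1 ?subr_ge0 ?gtrBl // -lt0n.
(* The factor c i is the probability that n copies do not all vanish. *)
pose a i := M i / c i.
have a0 i : 0 < a i by rewrite divr_gt0.
exists default_measure_display, (outcomes n), (coin_law hp), (coin_var a).
split.
- exact: coin_var_independent.
- by move=> i w; rewrite /= /coin_var; case: ifP => // _; exact: ltW.
- exact: coin_var_Lfun1.
- move=> i; have := coin_var_expected_max_copies hp (a0 i).
  by rewrite -/(c i) /a divfK // gt_eqF.
have q01 : 0 <= q <= 1 by rewrite q1 ltW.
apply: le_trans (coin_var_expectation_max_ge hp (k := k) a0 q01 _); last first.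
  by move=> j /negPf jk; rewrite /p jk.
(* Bernoulli's inequality bounds c i by n q. *)
have ap i : i != k -> M i / n%:R <= a i * p i.
  move=> /negPf ik; rewrite /a -mulrA ler_pM2l //.
  rewrite ler_pdivlMl // ler_pdivrMr // /c /p ik mulrC.
  have := bernoulli_ineq n q01; lra.
have akp : a k * p k = M k.
  by rewrite /a /c /p eqxx subrr expr0n gtn_eqF // subr0 divr1 mulr1.
have CE : C <= \sum_i a i * p i.
  rewrite /C Mk (bigD1 k) //= [leRHS](bigD1 k) //= akp mulrDr mulr_sumr.
  rewrite (_ : _ + _ = M k + \sum_(i < n | i != k) n%:R^-1 * M i); last first.
    by rewrite -subn1 natrB //; field; lra.
  by rewrite lerD2l; apply: ler_sum => i ik; rewrite mulrC ap.
rewrite lee_fin.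
apply: le_trans (ler_wpM2l _ CE); last by rewrite exprn_ge0 // subr_ge0.
apply: le_trans (ler_wpM2r (ltW C0) (bernoulli_ineq n.-1 q01)).
have : n.-1%:R * q * C <= n%:R * q * C.
  by rewrite !ler_wpM2r ?ler_nat ?leq_pred // ltW.
by rewrite mulrBl mul1r; lra.
Qed.
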